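(* There exists a sufficiently small constant $\delta>0$ such that if $\varepsilon\ge 6((\log d)/d)^{1/4}$, any turnstile streaming algorithm that, for a $d$-dimensional vector $x$ with integer entries bounded in absolute value by $\mathrm{poly}(d)$, estimates $\|x\|_\infty$ up to an additive error of $\varepsilon\|x\|_2$ with probability at least $1-\delta$ must use $\Omega(\varepsilon^{-2}\log(1/\varepsilon)\log d)$ bits of space.
   Context: In a turnstile stream, $x\in\mathbb R^d$ starts at $0$ and each update $(i,v)$ with $v$ an integer (possibly negative) sets $x_i\gets x_i+v$. *)

(* Defs.v *)
From HB Require Import structures.
From mathcomp Require Import all_boot all_order all_algebra.
From mathcomp Require Import all_classical all_reals all_analysis.
Set Implicit Arguments.
Unset Strict Implicit.
Unset Printing Implicit Defensive.
Import Order.TTheory GRing.Theory Num.Theory.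
Import numFieldNormedType.Exports.
Local Open Scope ring_scope.

Definition update (d : nat) : Type := ('I_d * int)%type.

Definition apply_update (d : nat) (x : 'rV[int]_d) (u : update d) : 'rV[int]_d :=
  \row_j (if j == u.1 then x 0 j + u.2 else x 0 j).

Definition stream_vector (d : nat) (sigma : seq (update d)) : 'rV[int]_d :=
  foldl (@apply_update d) 0 sigma.

(* The norm `|_| on row vectors is the library's mx_norm, i.e. the max norm. *)
Definition linf_norm (R : realType) (d : nat) (x : 'rV[int]_d) : R :=
  `| map_mx intr x : 'rV[R]_d |.

Definition l2_norm (R : realType) (d : nat) (x : 'rV[int]_d) : R :=
  Num.sqrt (\sum_(j < d) ((x 0 j)%:~R : R) ^+ 2).

(* A randomized one-pass algorithm whose memory between updates is s bits.
   There are two sources of randomness, neither charged to the space: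
   - omega : Omega, drawn once, which all the components may read;
   - fresh coins tossed at each update: alg_step omega u q q' is the
     probability of moving from memory q to memory q' upon reading u.
   Fresh coins for initialization and output can be taken from omega.
   The components do not depend on the position in the stream, so that a
   clock would have to be stored in the memory. *)
Record streaming_alg (R : realType) (dO : measure_display)
    (Omega : measurableType dO) (d s : nat) := StreamingAlg {
  alg_init : Omega -> s.-tuple bool;
  alg_step : Omega -> update d -> s.-tuple bool -> s.-tuple bool -> R;
  alg_out : Omega -> s.-tuple bool -> R;
  alg_step_ge0 : forall omega u q q', 0 <= alg_step omega u q q';
  alg_step_sum1 : forall omega u q, \sum_q' alg_step omega u q q' = 1;
  measurable_alg_init :
    forall q, measurable [set omega | alg_init omega = q]%classic;
  measurable_alg_step :
    forall u q q', measurable_fun setT (fun omega => alg_step omega u q q');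
  measurable_alg_out : forall q, measurable_fun setT (alg_out ^~ q)
}.

(* Conditional law of the memory given omega, after processing sigma. *)
Definition memory_law (R : realType) (dO : measure_display)
    (Omega : measurableType dO) (d s : nat) (A : streaming_alg R Omega d s)
    (omega : Omega) (sigma : seq (update d)) : s.-tuple bool -> R :=
  foldl (fun mu u q' => \sum_q mu q * alg_step A omega u q q')
        (fun q => (q == alg_init A omega)%:R) sigma.

Definition success_prob (R : realType) (dO : measure_display)
    (Omega : measurableType dO) (P : probability Omega R) (d s : nat)
    (A : streaming_alg R Omega d s) (eps : R) (sigma : seq (update d)) : \bar R :=
  let x := stream_vector sigma in
  (\int[P]_omega
     (\sum_(q | (`|alg_out A omega q - linf_norm R x| <= eps * l2_norm R x)%R)
        memory_law A omega sigma q)%:E)%E.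

(* Only the final vector is promised to have entries bounded by M; the length
   of the stream and the intermediate vectors are arbitrary. *)
Definition estimates_linf (R : realType) (dO : measure_display)
    (Omega : measurableType dO) (P : probability Omega R) (d s : nat)
    (A : streaming_alg R Omega d s) (M : nat) (eps delta : R) : Prop :=
  forall sigma : seq (update d),
    (forall j, (`|stream_vector sigma 0%R j| <= M)%N) ->
    ((1 - delta)%:E <= success_prob P A eps sigma)%E.

(* Main.v *)
Require Import Defs.
From HB Require Import structures.
From mathcomp Require Import all_boot all_order all_algebra.
From mathcomp Require Import all_classical all_reals all_analysis.
From mathcomp Require Import measurable_realfun ring lra zify.
Import Order.TTheory GRing.Theory Num.Theory.
Import numFieldNormedType.Exports.
Local Open Scope ring_scope.

(* One-way communication. Alice holds words a_0, ..., a_{L-1}, which she streams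
   as x = sum_l T^l v(a_l) with T = 4. Bob knows a level l, the words above it
   and a word b; he cancels the levels above l and adds T^l v(b). Here v(a) is
   the indicator of the graph of a : [k] -> [4k], with k of order eps^-2, so the
   max norm reveals whether a_l and b agree somewhere, the levels below l being
   negligible. The functions b |-> [a and b agree somewhere] of two words that
   differ in half of the places are far apart in L1, so a memory state
   that answers most queries b correctly leaves at most 2^k (4k)^(k/2) of the
   (4k)^k candidates for a_l. Decoding the levels from the top downwards,
   each memory state thus accounts for few sequences (a_l), which gives
   s >= c L k log k with L of order log d.

   For eps bounded away from 0 the same scheme is used with single bits a_l in
   one coordinate and a base T of order 1/(1 - eps). *)

(** * List decoding of sequences of symbols *)

Lemma sum_tuple_cons (R : nmodType) (X : finType) (L : nat)
    (F : L.+1.-tuple X -> R) :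
  \sum_A F A = \sum_(a : X) \sum_(r : L.-tuple X) F [tuple of a :: r].
Proof.
rewrite pair_big /= (reindex (fun p : X * L.-tuple X => [tuple of p.1 :: p.2])) //=.
exists (fun t => (thead t, [tuple of behead t])) => [[a r] _|t _] /=.
  by congr (_, _); apply/val_inj.
by case/tupleP: t => a r; apply/val_inj.
Qed.

(* The list [Lst i r] may depend on the symbols above position [i]; summing
   over the lowest position first keeps them fixed. *)
Lemma sum_list_decoding (R : realType) (X : finType) (V w : R) (L : nat)
    (Lst : nat -> seq X -> {set X}) :
  0 <= w -> (forall i r, #|Lst i r|%:R <= V) ->
  \sum_(A : L.-tuple X) \prod_(i < L)
     (if tnth A i \in Lst i (drop i.+1 A) then 1 else w)
    <= (V + w * #|X|%:R) ^+ L.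
Proof.
move=> w0; elim: L Lst => [|L IH] Lst hV.
  rewrite expr0 (big_pred1 [tuple]); first by rewrite big_ord0.
  by move=> t /=; apply/esym/eqP; exact: tuple0.
have V0 : 0 <= V by apply: le_trans (hV 0 [::]).
rewrite sum_tuple_cons exchange_big /= exprS mulrC.
pose P (r : L.-tuple X) := \prod_(i < L)
  (if tnth r i \in Lst i.+1 (drop i.+1 r) then 1 else w) : R.
have P0 r : 0 <= P r by apply: prodr_ge0 => i _; case: ifP.
apply: (@le_trans _ _ (\sum_(r : L.-tuple X) P r * (V + w * #|X|%:R))); last first.
  rewrite -mulr_suml ler_wpM2r ?addr_ge0 ?mulr_ge0 ?ler0n //.
  exact: (IH (fun i => Lst i.+1)).
apply: ler_sum => r _.
have cons_term a : \prod_(i < L.+1) (if tnth [tuple of a :: r] i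
      \in Lst i (drop i.+1 (a :: r)) then 1 else w) =
    P r * (if a \in Lst 0 r then 1 else w).
  rewrite big_ord_recl /= drop0 mulrC (tnth_nth a); congr (_ * _).
  by apply: eq_bigr => i _; rewrite !(tnth_nth a).
under eq_bigr => a _ do rewrite cons_term.
rewrite -mulr_sumr ler_wpM2l // (bigID (mem (Lst 0 r))) /=; apply: lerD.
  under eq_bigr => a -> do [].
  by rewrite sumr_const; apply: le_trans (hV 0 r).
under eq_bigr => a /negbTE -> do [].
rewrite sumr_const -[w *+ _]mulr_natr ler_wpM2l // ler_nat.
by apply: max_card.
Qed.

(* [mu A] is the law of the message sent on input [A]. As [mu A q <= 1], the
   factor [#|Q|] is a union bound over messages; the left-hand side comes from
   the tangent-line bound [expR x >= 1 + x] at the average number of failures. *)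
Lemma list_decoding_bound (R : realType) (X Q : finType) (V lam th : R) (L : nat)
    (Lst : Q -> nat -> seq X -> {set X}) (mu : L.-tuple X -> Q -> R) :
  0 <= lam -> (forall q i r, #|Lst q i r|%:R <= V) ->
  (forall A q, 0 <= mu A q) -> (forall A, \sum_q mu A q = 1) ->
  \sum_A \sum_q mu A q *
     \sum_(i < L) (tnth A i \notin Lst q i (drop i.+1 A))%:R
    <= th * L%:R * #|X|%:R ^+ L ->
  #|X|%:R ^+ L * expR (- (lam * (th * L%:R)))
    <= #|Q|%:R * (V + expR (- lam) * #|X|%:R) ^+ L.
Proof.
move=> lam0 hV mu0 mu1 hfail.
pose fails q (A : L.-tuple X) : R :=
  \sum_(i < L) (tnth A i \notin Lst q i (drop i.+1 A))%:R.
have mu_le1 A q : mu A q <= 1.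
  by rewrite -(mu1 A) (bigD1 q) //= lerDl sumr_ge0.
have step q A : expR (- (lam * fails q A)) =
    \prod_(i < L) (if tnth A i \in Lst q i (drop i.+1 A) then 1 else expR (- lam)).
  rewrite /fails mulr_sumr -sumrN expR_sum; apply: eq_bigr => i _.
  by case: ifP => _ /=; rewrite ?mulr0 ?oppr0 ?expR0 ?mulr1.
apply: (@le_trans _ _ (\sum_A \sum_q mu A q * expR (- (lam * fails q A)))).
  apply: (@le_trans _ _ (expR (- (lam * (th * L%:R))) *
    \sum_A \sum_q mu A q * (1 - lam * (fails q A - th * L%:R)))); last first.
    rewrite mulr_sumr; apply: ler_sum => A _; rewrite mulr_sumr.
    apply: ler_sum => q _; rewrite mulrCA ler_wpM2l //.
    rewrite (_ : - (lam * fails q A) =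
      - (lam * (th * L%:R)) + - (lam * (fails q A - th * L%:R))); last by ring.
    by rewrite expRD ler_wpM2l ?expR_ge0 // expR_ge1Dx.
  rewrite mulrC ler_wpM2l ?expR_ge0 //.
  have expand A q : mu A q * (1 - lam * (fails q A - th * L%:R)) =
      (1 + lam * (th * L%:R)) * mu A q - lam * (mu A q * fails q A) by ring.
  under eq_bigr => A _ do under eq_bigr => q _ do rewrite expand.
  under eq_bigr => A _ do rewrite sumrB -!mulr_sumr mu1 mulr1.
  rewrite sumrB -mulr_sumr sumr_const card_tuple -[_ *+ (_ ^ _)]mulr_natr natrX.
  move: hfail; rewrite -/fails => /(ler_wpM2l lam0).
  set a := #|X|%:R ^+ L; set S := (X in lam * X <= _) => h.
  have -> : (\sum_i \sum_q mu i q * fails q i) = S by [].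
  by nra.
apply: (@le_trans _ _ (\sum_A \sum_q expR (- (lam * fails q A)))).
  apply: ler_sum => A _; apply: ler_sum => q _.
  by rewrite ler_piMl ?expR_ge0.
rewrite exchange_big /= -sum1_card natr_sum mulr_suml; apply: ler_sum => q _.
rewrite mul1r; under eq_bigr => A _ do rewrite step.
exact: (@sum_list_decoding _ _ V (expR (- lam)) L (Lst q) (expR_ge0 _) (hV q)).
Qed.

(** * Markov kernels at a fixed seed, and the choice of a seed *)

Section Run.
Context {R : realType} {dO : measure_display} {Omega : measurableType dO}.
Context {d s : nat} (A : streaming_alg R Omega d s).
Implicit Types (omega : Omega) (sigma tau : seq (update d)) (q : s.-tuple bool).

(** Generalizes [memory_law] to an arbitrary initial law, so that Bob can resume from the memory
    state that Alice leaves. *)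
Definition run omega (mu : s.-tuple bool -> R) sigma : s.-tuple bool -> R :=
  foldl (fun mu u q' => \sum_q mu q * alg_step A omega u q q') mu sigma.

Definition transition omega sigma q : s.-tuple bool -> R :=
  run omega (fun q' => (q' == q)%:R) sigma.

Lemma run_ge0 omega mu sigma q :
  (forall q', 0 <= mu q') -> 0 <= run omega mu sigma q.
Proof.
elim: sigma mu => [|u sigma IH] mu mu0 /=; first exact: mu0.
apply: IH => q'; apply: sumr_ge0 => q1 _.
by rewrite mulr_ge0 ?alg_step_ge0.
Qed.

Lemma run_sum omega mu sigma : \sum_q run omega mu sigma q = \sum_q mu q.
Proof.
elim: sigma mu => [|u sigma IH] mu //=.
rewrite IH exchange_big /=; apply: eq_bigr => q _.
by rewrite -mulr_sumr alg_step_sum1 mulr1.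
Qed.

Lemma run_lin omega mu sigma q' :
  run omega mu sigma q' = \sum_q mu q * transition omega sigma q q'.
Proof.
rewrite /transition; elim/last_ind: sigma q' => [|sigma u IH] q' /=.
  rewrite (bigD1 q') //= eqxx mulr1 big1 ?addr0 // => q /negbTE.
  by rewrite eq_sym => ->; rewrite mulr0.
rewrite /run -cats1 foldl_cat /= -/(run omega mu sigma).
under eq_bigr => q1 _ do rewrite IH mulr_suml.
rewrite exchange_big /=; apply: eq_bigr => q _.
rewrite foldl_cat /= mulr_sumr; apply: eq_bigr => q1 _.
by rewrite mulrA.
Qed.

Lemma memory_law_cat omega sigma tau q' :
  memory_law A omega (sigma ++ tau) q' =
  \sum_q memory_law A omega sigma q * transition omega tau q q'.
Proof. by rewrite /memory_law foldl_cat -run_lin. Qed.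

Lemma memory_law_ge0 omega sigma q : 0 <= memory_law A omega sigma q.
Proof. by apply: run_ge0 => q'; rewrite ler0n. Qed.

Lemma sum_delta (T : finType) (x : T) : \sum_q (q == x)%:R = 1 :> R.
Proof. by rewrite (bigD1 x) //= eqxx big1 ?addr0 // => q /negbTE ->. Qed.

Lemma memory_law_sum omega sigma : \sum_q memory_law A omega sigma q = 1.
Proof. by rewrite run_sum sum_delta. Qed.

Lemma transition_ge0 omega sigma q q' : 0 <= transition omega sigma q q'.
Proof. by apply: run_ge0 => ?; rewrite ler0n. Qed.

Lemma transition_sum omega sigma q : \sum_q' transition omega sigma q q' = 1.
Proof. by rewrite run_sum sum_delta. Qed.

Lemma measurable_memory_law sigma q :
  measurable_fun setT (fun omega => memory_law A omega sigma q).
Proof.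
elim/last_ind: sigma q => [|sigma u IH] q.
  rewrite /memory_law /=.
  rewrite (_ : (fun _ => _) = \1_[set omega | alg_init A omega = q]%classic).
    exact: measurable_indic (measurable_alg_init A q).
  apply/funext => omega; rewrite indicE; case: eqP => [->|h].
    by rewrite mem_set.
  by rewrite memNset // => /esym.
rewrite (_ : (fun _ => _) = (fun omega => \sum_q1
    memory_law A omega sigma q1 * alg_step A omega u q1 q)); last first.
  by apply/funext => omega; rewrite /memory_law -cats1 foldl_cat.
apply: measurable_sum => q1.
by apply: measurable_funM => //; exact: measurable_alg_step.
Qed.

(** The integrand of [success_prob], with the target [x] kept separate from the stream so that it
    can be rewritten on its own. *)
Definition success_at (eps : R) (x : 'rV[int]_d) sigma omega : R :=
  \sum_(q | `|alg_out A omega q - linf_norm R x| <= eps * l2_norm R x)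
     memory_law A omega sigma q.

Lemma measurable_success_at eps x sigma :
  measurable_fun setT (success_at eps x sigma).
Proof.
rewrite (_ : success_at _ _ _ = (fun omega => \sum_q
  \1_[set omega | `|alg_out A omega q - linf_norm R x| <= eps * l2_norm R x]%classic omega
   * memory_law A omega sigma q)); last first.
  apply/funext => omega; rewrite /success_at big_mkcond /=; apply: eq_bigr => q _.
  rewrite indicE; case: ifPn => h.
    by rewrite mem_set ?mul1r.
  by rewrite memNset ?mul0r // => /=; apply/negP.
apply: measurable_sum => q; apply: measurable_funM; last exact: measurable_memory_law.
apply: measurable_indic.
rewrite -[X in measurable X]setTI.
apply: measurable_fun_le => //.
apply: measurableT_comp => //.
apply: measurable_funB => //; exact: measurable_alg_out.
Qed.

Lemma success_at_ge0 eps x sigma omega : 0 <= success_at eps x sigma omega.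
Proof. by apply: sumr_ge0 => q _; exact: memory_law_ge0. Qed.

(** Averaging over the seed: if every seed fell short, integrating the total success over [P] would
    contradict the guarantee summed over [I]. The factor 2 leaves slack, so that a weak inequality
    between integrals is enough. *)
Lemma exists_good_seed (P : probability Omega R) (M : nat) (eps delta : R)
    (I : finType) (sg : I -> seq (update d)) :
  0 < delta -> estimates_linf P A M eps delta ->
  (forall i j, (`|stream_vector (sg i) 0%R j| <= M)%N) ->
  exists omega, (1 - 2 * delta) * #|I|%:R <=
    \sum_i success_at eps (stream_vector (sg i)) (sg i) omega.
Proof.
move=> delta0 hA hM; apply: contrapT => /forallNP hn.
have [I0|I0] := posnP #|I|.
  by apply: (hn point); rewrite I0 mulr0 sumr_ge0 // => i _; exact: success_at_ge0.
have h1 : (((1 - delta) * #|I|%:R)%:E <= \sum_i success_prob P A eps (sg i))%E.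
  rewrite mulr_natr -sumr_const -sumEFin; apply: lee_sum => i _.
  by apply: hA => j; exact: hM.
have h2 : (\sum_i success_prob P A eps (sg i) <= ((1 - 2 * delta) * #|I|%:R)%:E)%E.
  rewrite /success_prob -ge0_integral_sum //=; last 2 first.
  - by move=> i; apply/measurable_EFinP; exact: measurable_success_at.
  - by move=> i omega _; rewrite lee_fin; exact: success_at_ge0.
  rewrite -[leRHS]mule1 -(@probability_setT _ _ _ P) -integral_cst //.
  apply: ge0_le_integral => //=.
  - by move=> omega _; apply: sume_ge0 => i _; rewrite lee_fin; exact: success_at_ge0.
  - by apply: emeasurable_sum => i; apply/measurable_EFinP; exact: measurable_success_at.
  - move=> omega _; rewrite sumEFin lee_fin; apply/ltW; rewrite ltNge; apply/negP.
    exact: hn.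
have := le_trans h1 h2; rewrite lee_fin ler_pM2r ?ltr0n //.
lra.
Qed.
End Run.

(** * Concatenation of streams, and streams with a prescribed vector *)

Section Streams.
Context {d : nat}.
Implicit Types (x y : 'rV[int]_d) (sigma tau : seq (update d)).

Lemma foldl_apply_update x sigma :
  foldl (@apply_update d) x sigma = x + stream_vector sigma.
Proof.
rewrite /stream_vector; elim/last_ind: sigma => [|sigma u IH]; first by rewrite addr0.
rewrite -!cats1 !foldl_cat IH /=; apply/rowP => j; rewrite !mxE.
by case: ifP => _; rewrite ?addrA.
Qed.

Lemma stream_vector_cat sigma tau :
  stream_vector (sigma ++ tau) = stream_vector sigma + stream_vector tau.
Proof. by rewrite {1}/stream_vector foldl_cat foldl_apply_update. Qed.

Definition stream_of x : seq (update d) := [seq (j, x 0 j) | j <- enum 'I_d].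

Lemma stream_vector_stream_of x : stream_vector (stream_of x) = x.
Proof.
have gen (e : seq 'I_d) : uniq e ->
    stream_vector [seq (j, x 0 j) | j <- e] = \row_j (if j \in e then x 0 j else 0).
  elim: e => [|i e IH] /=; first by move=> _; apply/rowP => j; rewrite !mxE.
  move=> /andP[ie /IH he]; rewrite -cat1s stream_vector_cat he.
  apply/rowP => j; rewrite !mxE inE add0r /=; case: eqP => [->|_] /=.
    by rewrite (negbTE ie) addr0.
  by rewrite add0r.
rewrite gen ?enum_uniq //; apply/rowP => j; by rewrite mxE mem_enum.
Qed.
End Streams.

(** * Base [T] expansions whose digits are vectors, lowest level first *)

Section Horner.
Context {X : Type} {d : nat} (T : nat) (v : X -> 'I_d -> nat).
Implicit Types r t : seq X.

Definition weighted_sum r (j : 'I_d) : nat :=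
  foldr (fun a acc => v a j + T * acc)%N 0%N r.

Lemma weighted_sum_cat r t j :
  weighted_sum (r ++ t) j = (weighted_sum r j + T ^ size r * weighted_sum t j)%N.
Proof.
elim: r => [|a r IH] /=; first by rewrite expn0 mul1n.
by rewrite IH expnS mulnDr addnA mulnA.
Qed.

(** A geometric sum, stated without division: all the lower levels together stay below a fraction 1
    / (T - 1) of the current level. *)
Lemma weighted_sum_lt r j : (0 < T)%N -> (forall a, v a j <= 1)%N ->
  (T.-1 * weighted_sum r j < T ^ size r)%N.
Proof.
move=> T0 v1; elim: r => [|a r IH] /=; first by rewrite muln0.
rewrite expnS; have := leq_mul (leqnn T) IH; have := leq_mul (leqnn T.-1) (v1 a).
by have := prednK T0; move: T.-1 => t; set E := (_ ^ _)%N; lia.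
Qed.

(** The same geometric sum for the l1 mass; the summand [k] on the left makes the induction
    close. *)
Lemma weighted_sum_l1 r k : (0 < T)%N -> (forall a, \sum_j v a j <= k)%N ->
  (T.-1 * (\sum_j weighted_sum r j) + k <= k * T ^ size r)%N.
Proof.
move=> T0 vk; elim: r => [|a r IH] /=; first by rewrite big1 // muln0 muln1.
rewrite expnS big_split /= -big_distrr /=.
have := leq_mul (leqnn T) IH; have := leq_mul (leqnn T.-1) (vk a).
have := prednK T0; move: T.-1 => t; set E := (_ ^ _)%N.
by set S := (\sum_j v a j)%N; set W := (\sum_j weighted_sum r j)%N; lia.
Qed.
End Horner.

(* The final vector, seen at level [size r]: [r] holds the symbols of the lower
   levels, those of the higher levels have been cancelled. *)
Definition query_vector {X Y : Type} {d : nat} (T : nat) (v : X -> 'I_d -> nat)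
    (u : Y -> 'I_d -> nat) (r : seq X) (a : X) (y : Y) : 'rV[int]_d :=
  \row_j ((weighted_sum T v r j + T ^ size r * (v a j + u y j))%N)%:Z.

Lemma l1_error (R : realDomainType) (b : bool) (p : R) : 0 <= p <= 1 ->
  `|b%:R - p| = if b then 1 - p else p.
Proof.
case: b => /andP[p0 p1] /=; first by rewrite ger0_norm ?subr_ge0.
by rewrite mulr0n sub0r normrN ger0_norm.
Qed.

(** * From a streaming algorithm to a one-way protocol *)

Section Protocol.
Context {R : realType} {X Y : finType} {d s L T : nat}.
Context (v : X -> 'I_d -> nat) (u : Y -> 'I_d -> nat) (f : X -> Y -> bool).

Definition alice_stream (A : seq X) : seq (update d) :=
  stream_of (\row_j (weighted_sum T v A j)%:Z).

(** The word list [r] starts just above level [l], hence the weight [T ^ l.+1] of the part that is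
    cancelled. *)
Definition bob_stream (l : nat) (r : seq X) (y : Y) : seq (update d) :=
  stream_of (\row_j ((T ^ l * u y j)%N%:Z - (T ^ l.+1 * weighted_sum T v r j)%N%:Z)).

Lemma alice_bob_vector (A : L.-tuple X) (l : 'I_L) y :
  stream_vector (alice_stream A ++ bob_stream l (drop l.+1 A) y) =
  query_vector T v u (take l A) (tnth A l) y.
Proof.
rewrite stream_vector_cat !stream_vector_stream_of; apply/rowP => j; rewrite !mxE.
have hl : (l < size A)%N by rewrite size_tuple.
rewrite -{1}(cat_take_drop l A) (drop_nth (tnth A l) hl) weighted_sum_cat /=.
rewrite size_take hl -tnth_nth.
rewrite !PoszD !PoszM expnS; lia.
Qed.

Context {dO : measure_display} {Omega : measurableType dO}.

(** Bob compares the output with the threshold [tau l] to guess [f]. At a good seed the average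
    failure probability is at most 2 delta. By Markov's inequality the true symbol is then missing
    from the list of its memory state with average frequency at most 2 delta / eta, and
    [list_decoding_bound] applies. *)
Lemma protocol_bound (P : probability Omega R) (A : streaming_alg R Omega d s)
    (M : nat) (eps delta eta lam V : R) (tau : nat -> R) :
  0 < delta -> 0 < eta -> 0 <= lam -> (0 < #|Y|)%N ->
  estimates_linf P A M eps delta ->
  (forall p : Y -> R,
    #|[set a | \sum_y `|(f a y)%:R - p y| <= eta * #|Y|%:R]|%:R <= V) ->
  (forall r a y j, (size r < L)%N -> (`|query_vector T v u r a y 0%R j| <= M)%N) ->
  (forall r a y out, (size r < L)%N ->
    `|out - linf_norm R (query_vector T v u r a y)|
      <= eps * l2_norm R (query_vector T v u r a y) ->
    (tau (size r) < out) = f a y) ->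
  #|X|%:R ^+ L * expR (- (lam * (2 * delta / eta * L%:R)))
    <= 2 ^+ s * (V + expR (- lam) * #|X|%:R) ^+ L.
Proof.
move=> delta0 eta0 lam0 Y0 hA hV hM hdec.
pose sg (i : L.-tuple X * 'I_L * Y) :=
  alice_stream i.1.1 ++ bob_stream i.1.2 (drop i.1.2.+1 i.1.1) i.2.
have szlt (B : L.-tuple X) (l : 'I_L) : size (take l B) = l.
  by rewrite size_take size_tuple ltn_ord.
have [|omega homega] := @exists_good_seed _ _ _ _ _ A P M eps delta _ sg delta0 hA.
  move=> [[B l] y] j; rewrite /sg alice_bob_vector; apply: hM.
  by rewrite szlt.
pose mu (B : L.-tuple X) q := memory_law A omega (alice_stream B) q.
(* The probability that Bob, starting from memory [q], answers yes to the query [y]; [Lst] collects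
   the symbols whose answer table is L1-close to these probabilities. *)
pose p q l r y := \sum_(q' | tau l < alg_out A omega q')
  transition A omega (bob_stream l r y) q q'.
pose Lst q l r := [set a | \sum_y `|(f a y)%:R - p q l r y| <= eta * #|Y|%:R].
have p01 q l r y : 0 <= p q l r y <= 1.
  rewrite /p sumr_ge0 /=; last by move=> *; exact: transition_ge0.
  rewrite -(transition_sum A omega (bob_stream l r y) q).
  by rewrite big_mkcond ler_sum // => q' _; case: ifP => // _; exact: transition_ge0.
have err (B : L.-tuple X) (l : 'I_L) y :
    \sum_q mu B q * `|(f (tnth B l) y)%:R - p q l (drop l.+1 B) y|
    <= 1 - success_at A eps (stream_vector (sg (B, l, y))) (sg (B, l, y)) omega.
  rewrite lerBrDr -lerBrDl.
  apply: (@le_trans _ _ (\sum_q mu B q *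
      (1 - `|(f (tnth B l) y)%:R - p q l (drop l.+1 B) y|))); last first.
    under eq_bigr => q _ do rewrite mulrBr mulr1.
    by rewrite sumrB memory_law_sum.
  rewrite /success_at /sg /= alice_bob_vector.
  under eq_bigr => q _ do rewrite memory_law_cat.
  rewrite exchange_big /=; apply: ler_sum => q _.
  rewrite -mulr_sumr ler_wpM2l ?memory_law_ge0 //.
  (* By [hdec], every final state with an accurate output passes the threshold test correctly. *)
  apply: (@le_trans _ _ (\sum_(q' | (tau l < alg_out A omega q') == f (tnth B l) y)
      transition A omega (bob_stream l (drop l.+1 B) y) q q')).
    rewrite big_mkcond [leRHS]big_mkcond /=; apply: ler_sum => q' _.
    case: ifP => [h|_]; last by case: ifP => // _; exact: transition_ge0.
    by have := hdec _ _ _ _ _ h; rewrite szlt => ->; rewrite ?eqxx.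
  rewrite l1_error //; case: (f _ _).
    by rewrite subKr le_eqVlt; apply/orP; left; apply/eqP/eq_bigl => q'; rewrite eqb_id.
  rewrite -(transition_sum A omega (bob_stream l (drop l.+1 B) y) q).
  rewrite [X in _ <= X - _](bigID (fun q' => tau l < alg_out A omega q')) /=.
  rewrite addrAC subrr add0r le_eqVlt; apply/orP; left; apply/eqP/eq_bigl => q'.
  by rewrite eqbF_neg.
have -> : 2 ^+ s = #|{: s.-tuple bool}|%:R :> R by rewrite card_tuple card_bool natrX.
apply: (@list_decoding_bound _ _ _ V lam _ L Lst mu lam0) => //.
- by move=> q i r; exact: hV.
- by move=> B q; exact: memory_law_ge0.
- by move=> B; exact: memory_law_sum.
have Y0R : 0 < #|Y|%:R :> R by rewrite ltr0n.
(* Markov's inequality: each missing symbol contributes more than [eta * #|Y|] to the total L1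
   error, which is bounded by the total failure probability. *)
rewrite -(ler_pM2l (mulr_gt0 eta0 Y0R)).
apply: (@le_trans _ _ (\sum_(i : L.-tuple X * 'I_L * Y)
    (1 - success_at A eps (stream_vector (sg i)) (sg i) omega))); last first.
  rewrite sumrB sumr_const; move: homega; rewrite !card_prod card_tuple card_ord.
  rewrite -[1 *+ _]/(_%:R) !natrM natrX => h.
  set N := #|X|%:R ^+ L in h *.
  rewrite (_ : eta * #|Y|%:R * _ = 2 * delta * (N * L%:R * #|Y|%:R)); last first.
    by field; rewrite gt_eqF.
  lra.
rewrite -(pair_bigA _ (fun b y =>
  1 - success_at A eps (stream_vector (sg (b, y))) (sg (b, y)) omega)) /=.
rewrite -(pair_bigA _ (fun B l => \sum_y
  (1 - success_at A eps (stream_vector (sg (B, l, y))) (sg (B, l, y)) omega))) /=.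
rewrite mulr_sumr; apply: ler_sum => B _.
apply: (@le_trans _ _ (\sum_(l < L) \sum_y
   \sum_q mu B q * `|(f (tnth B l) y)%:R - p q l (drop l.+1 B) y|)); last first.
  by apply: ler_sum => l _; apply: ler_sum => y _; exact: err.
under [leRHS]eq_bigr => l _ do rewrite exchange_big /=.
rewrite exchange_big /= mulr_sumr; apply: ler_sum => q _.
rewrite mulrCA mulr_sumr mulr_sumr; apply: ler_sum => l _.
rewrite -mulr_sumr ler_wpM2l ?memory_law_ge0 //.
rewrite inE -ltNge; case: ltP => [/ltW|_]; first by rewrite mulr1.
by rewrite mulr0 sumr_ge0.
Qed.
End Protocol.

(** * Combinatorics of words that agree somewhere *)

Section Agreement.
Context {k m : nat}.
Local Notation word := {ffun 'I_k -> 'I_m}.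
Implicit Types a b : word.

Definition collide a b : bool := [exists i, a i == b i].

Definition diff_set a b : {set 'I_k} := [set i | a i != b i].

(** Union bound over the set of places where [b] may differ from [a]: at most [2 ^ k] such sets,
    each leaving at most [m ^ t] words. *)
Lemma card_ball a (t : nat) : (0 < m)%N ->
  (#|[set b | #|diff_set a b| <= t]| <= 2 ^ k * m ^ t)%N.
Proof.
move=> m0.
pose F (D : {set 'I_k}) : {pred word} :=
  family (fun i => if i \in D then predT else pred1 (a i)).
have cF D : (#|F D| = m ^ #|D|)%N.
  rewrite card_family foldrE big_map big_enum /= (bigID (mem D)) /=.
  rewrite [X in (_ * X)%N]big1 => [|i /negbTE ->]; last by rewrite card1.
  rewrite muln1 (eq_bigr (fun=> m)) => [|i ->]; last by rewrite card_ord.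
  by rewrite prod_nat_const.
apply: (@leq_trans #|(\bigcup_(D : {set 'I_k} | (#|D| <= t)%N) [set b in F D])%SET|).
  apply/subset_leq_card/fintype.subsetP => b; rewrite inE => hb.
  apply/bigcupP; exists (diff_set a b) => //; rewrite inE.
  apply/familyP => i; rewrite inE; case: ifPn => // /negPn/eqP ab.
  by rewrite inE ab.
apply: (@leq_trans (\sum_(D : {set 'I_k} | (#|D| <= t)%N) m ^ t)%N).
  apply: (big_ind2 (fun (A : {set word}) n => #|A| <= n)%N); first by rewrite cards0.
    by move=> A n B p An Bp; apply: leq_trans (leq_card_setU A B).1 (leq_add An Bp).
  by move=> D hD; rewrite cardsE cF leq_pexp2l.
rewrite sum_nat_const leq_mul2r; apply/orP; right.
apply: leq_trans (max_card _) _.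
by rewrite -cardsT -powersetT card_powerset cardsT card_ord.
Qed.

(* Count the words [b] that meet [a] at exactly one place, chosen in
   [diff_set a a'], and avoid both [a] and [a'] elsewhere. *)
Lemma collide_separated a a' :
  (#|diff_set a a'| * (m - 2) ^ k.-1 <=
   #|[set b | collide a b && ~~ collide a' b]|)%N.
Proof.
pose F (i : 'I_k) : {pred word} :=
  family (fun j => if j == i then pred1 (a i) else [pred c | (c != a j) && (c != a' j)]).
have cF i : ((m - 2) ^ k.-1 <= #|F i|)%N.
  rewrite card_family foldrE big_map big_enum /= (bigD1 i) //= eqxx card1 mul1n.
  rewrite -[k in k.-1]card_ord -(cardC1 i) -prod_nat_const.
  apply: leq_prod => j /negbTE ->.
  have card2 : (#|[set a j; a' j]| <= 2)%N by rewrite cards2; case: (_ != _).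
  have -> : #|[eta [pred c | (c != a j) && (c != a' j)]]| = #|~: [set a j; a' j]|.
    by apply: eq_card => c; rewrite !inE negb_or.
  by rewrite cardsCs finset.setCK card_ord leq_sub2l.
rewrite -sum_nat_const.
apply: (@leq_trans (\sum_(i in diff_set a a') #|F i|)%N).
  by apply: leq_sum => i _; exact: cF.
under eq_bigr => i _ do rewrite -sum1_card big_mkcond.
rewrite exchange_big /= -sum1_card [leqRHS]big_mkcond.
apply: leq_sum => b _; rewrite -big_mkcondr /=.
(* A word of [F i] meets [a] only at [i], so the families are disjoint and each [b] is counted at
   most once. *)
have uniqF i j : b \in F i -> b \in F j -> i = j.
  move=> /familyP bi /familyP bj; apply/eqP/contraT => ij.
  have := bj i; have := bi i; rewrite eqxx (negbTE ij) !inE => /eqP ->.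
  by rewrite eqxx.
have [i /andP[iD iF]|none] := pickP [pred i | (i \in diff_set a a') && (b \in F i)];
  last by rewrite big_pred0.
rewrite (big_pred1 i) => [|j]; last first.
  by apply/idP/eqP => [/andP[_ jF]|->]; [exact: (uniqF j i)|rewrite iD].
rewrite inE ifT //; move/familyP: iF => iF; apply/andP; split.
  apply/existsP; exists i; have := iF i; rewrite eqxx inE => /eqP ->.
  by rewrite eqxx.
apply/existsPn => j; have := iF j; case: eqP => [->|_]; rewrite !inE.
  by move=> /eqP ->; move: iD; rewrite inE eq_sym.
by move=> /andP[_]; rewrite eq_sym.
Qed.

Lemma bernoulli_nat (R : realDomainType) (x : R) (n : nat) :
  0 <= x <= 1 -> 1 - n%:R * x <= (1 - x) ^+ n.
Proof.
move=> /andP[x0 x1]; elim: n => [|n IH]; first by rewrite mul0r subr0 expr0.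
rewrite exprS; apply: (@le_trans _ _ ((1 - x) * (1 - n%:R * x))).
  rewrite -natr1; have : 0 <= n%:R * x * x by rewrite !mulr_ge0.
  by lra.
by rewrite ler_wpM2l // subr_ge0.
Qed.

Context {R : realType}.

(** With m = 4k, Bernoulli's inequality gives (1 - 2/m)^(k-1) >= 1/2, and half of the places is m/8;
    the product of the two is m/16. *)
Lemma collide_separated_density a a' : (0 < k)%N -> m = (4 * k)%N ->
  (k <= 2 * #|diff_set a a'|)%N ->
  m%:R ^+ k / 16 <= #|[set b | collide a b && ~~ collide a' b]|%:R :> R.
Proof.
move=> k0 mE hD.
apply: (@le_trans _ _ (#|diff_set a a'| * (m - 2) ^ k.-1)%:R); last first.
  by rewrite ler_nat; exact: collide_separated.
have m0 : 0 < m%:R :> R by rewrite ltr0n; lia.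
have hb : 1 / 2 <= (1 - 2 / m%:R) ^+ k.-1 :> R.
  apply: le_trans (@bernoulli_nat R (2 / m%:R) k.-1 _); last first.
    by rewrite divr_ge0 //= ler_pdivrMr // mul1r (ler_nat _ 2); lia.
  rewrite mulrA lerBrDr -lerBrDl ler_pdivrMr //.
  have : k.-1%:R * 4 <= m%:R :> R by rewrite -natrM ler_nat; lia.
  by lra.
have -> : (#|diff_set a a'| * (m - 2) ^ k.-1)%:R =
    #|diff_set a a'|%:R * m%:R ^+ k.-1 * (1 - 2 / m%:R) ^+ k.-1 :> R.
  rewrite natrM natrX natrB; last by lia.
  by rewrite -mulrA -exprMn mulrBr mulr1 mulrCA divff ?mulr1 // gt_eqF.
have -> : m%:R ^+ k = m%:R * m%:R ^+ k.-1 :> R by rewrite -exprS prednK.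
have hD' : m%:R / 8 <= #|diff_set a a'|%:R :> R.
  rewrite ler_pdivrMr // -natrM ler_nat; lia.
apply: (@le_trans _ _ (m%:R / 8 * m%:R ^+ k.-1 * (1 / 2))); first by lra.
by rewrite ler_pM // ?mulr_ge0 ?divr_ge0 ?exprn_ge0 ?ler0n ?ler_wpM2r // ?exprn_ge0 // ltW.
Qed.

(** Two members of the list have answer tables at L1 distance at most a fraction 2/40 of all words,
    below the 1/16 that a difference in half of the places would force. Hence the list lies in a
    ball of radius [k./2] around any of its members. *)
Lemma collide_list (p : word -> R) : (0 < k)%N -> m = (4 * k)%N ->
  (#|[set a | (\sum_b `|(collide a b)%:R - p b| <= 40^-1 * #|{: word}|%:R)%R]|
    <= 2 ^ k * m ^ k./2)%N.
Proof.
move=> k0 mE; set S := [set a | _].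
have [->|[a0 a0S]] := set_0Vmem S; first by rewrite cards0.
apply: leq_trans (@card_ball a0 k./2 _); last by lia.
apply/subset_leq_card/fintype.subsetP => a; rewrite !inE => aS.
rewrite leqNgt; apply/negP => far.
have := @collide_separated_density a0 a k0 mE _.
have {}far : (k <= 2 * #|diff_set a0 a|)%N by lia.
move=> /(_ far).
have cw : #|{: word}|%:R = m%:R ^+ k :> R by rewrite card_ffun !card_ord natrX.
rewrite -cw => h1.
(* Where the two tables differ, the triangle inequality through [p b] costs at least 1. *)
have h2 : #|[set b | collide a0 b && ~~ collide a b]|%:R <=
   \sum_b `|(collide a0 b)%:R - p b| + \sum_b `|(collide a b)%:R - p b|.
  rewrite -big_split -sum1_card natr_sum big_mkcond; apply: ler_sum => b _ /=.
  rewrite inE; case: ifP => [/andP[-> /negbTE ->]|_]; last by rewrite addr_ge0.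
  rewrite sub0r normrN; apply: le_trans (ler_normD _ _).
  by rewrite subrK normr1.
move: a0S; rewrite inE => a0S.
have : 0 < #|{: word}|%:R :> R.
  by rewrite cw exprn_gt0 // ltr0n; lia.
by lra.
Qed.
End Agreement.

(** * Bounds on norms and on ln 2 *)

Section Norms.
Context {R : realType} {d : nat}.

Lemma linf_norm_ge (x : 'rV[int]_d) j : `|(x 0 j)%:~R| <= linf_norm R x :> R.
Proof.
rewrite /linf_norm /Num.norm /= mx_normrE.
by have := @le_bigmax _ R _ 0 (fun i => `|map_mx intr x i.1 i.2| : R) (0, j); rewrite !mxE.
Qed.

Lemma linf_norm_le (x : 'rV[int]_d) (B : R) : 0 <= B ->
  (forall j, `|(x 0 j)%:~R| <= B) -> linf_norm R x <= B.
Proof.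
move=> B0 hB; rewrite /linf_norm /Num.norm /= mx_normrE; apply: bigmax_le => // -[i j] _ /=.
by rewrite !mxE ord1.
Qed.

(** Hoelder's inequality: the squared l2 norm is at most the max norm times the l1 norm. *)
Lemma l2_norm_nat_le (z : 'I_d -> nat) (B S : R) :
  (forall j, (z j)%:R <= B) -> (\sum_j z j)%:R <= S -> 0 <= B ->
  l2_norm R (\row_j (z j)%:Z) <= Num.sqrt (B * S).
Proof.
move=> zB zS B0; rewrite /l2_norm; apply: ler_wsqrtr.
apply: (@le_trans _ _ (B * (\sum_j z j)%:R)); last by rewrite ler_wpM2l.
rewrite natr_sum mulr_sumr; apply: ler_sum => j _.
by rewrite mxE expr2; apply: ler_wpM2r; [exact: ler0n|exact: zB].
Qed.
End Norms.

Lemma ln2_ge (R : realType) : 2^-1 <= ln 2 :> R.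
Proof.
rewrite -[leLHS]expRK ler_ln ?posrE ?expR_gt0 //.
have := expR_ge1Dx (- 2^-1 : R); rewrite expRN => h.
rewrite -[expR _]invrK -[leRHS]invrK lef_pV2 ?posrE ?invr_gt0 ?expR_gt0 //.
lra.
Qed.

Lemma ln2_le (R : realType) : ln 2 <= 1 :> R.
Proof. by apply: le_trans (@le_ln1Dx R 1 _) _ => //; lra. Qed.

(** * The space bound for small [eps] *)

Section Meets.
Context {R : realType} {dO : measure_display} {Omega : measurableType dO}.
Context {d s k : nat}.
Local Notation m := (4 * k)%N.
Local Notation word := {ffun 'I_k -> 'I_m}.

(** [iota] places the grid of pairs (place, letter) among the coordinates. *)
Definition graph_indicator (iota : 'I_k * 'I_m -> 'I_d) (a : word) (j : 'I_d) : nat :=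
  [exists i, iota (i, a i) == j].

Lemma graph_indicator_l1 iota a : (\sum_j graph_indicator iota a j <= k)%N.
Proof.
rewrite -[leqRHS]card_ord -sum1_card.
apply: (@leq_trans (\sum_j \sum_(i : 'I_k) (iota (i, a i) == j))%N).
  apply: leq_sum => j _; rewrite /graph_indicator.
  case: existsP => // -[i hi]; rewrite (bigD1 i) //= hi; lia.
rewrite exchange_big /=; apply: leq_sum => i _.
by rewrite (bigD1 (iota (i, a i))) //= eqxx big1 // => j /negbTE; rewrite eq_sym => ->.
Qed.

Lemma collide_graphP iota a b : injective iota ->
  reflect (exists j, graph_indicator iota a j + graph_indicator iota b j = 2)%N
    (collide a b).
Proof.
move=> inj; apply: (iffP existsP) => [[i /eqP ab]|[j]].
  exists (iota (i, a i)); rewrite /graph_indicator.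
  have -> : [exists i0, iota (i0, a i0) == iota (i, a i)] by apply/existsP; exists i.
  by have -> : [exists i0, iota (i0, b i0) == iota (i, a i)]
    by apply/existsP; exists i; rewrite ab.
rewrite /graph_indicator; case: existsP => [[i /eqP ai]|_]; case: existsP => [[i' /eqP bi']|_] //= _.
exists i.
by move: bi'; rewrite -ai => /inj[ii]; rewrite -ii => ->.
Qed.

(** Put E = 4^(size r). A common point makes the max norm at least 2E; otherwise it is at most E +
    E/3. The threshold 5E/3 is the midpoint, and the condition on [k] keeps the additive error below
    E/3, as the squared l2 norm is at most 3E times 3kE. *)
Lemma collide_decoding (eps : R) iota (r : seq word) a b out :
  injective iota -> 0 < eps -> 81 * eps ^+ 2 * k%:R < 1 ->
  let x := query_vector 4 (graph_indicator iota) (graph_indicator iota) r a b in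
  `|out - linf_norm R x| <= eps * l2_norm R x ->
  (5 / 3 * 4 ^+ size r < out) = collide a b.
Proof.
move=> inj eps0 epsk x; set v := graph_indicator iota in x *.
pose W j := weighted_sum 4 v r j.
have v1 c j : (v c j <= 1)%N by rewrite /v /graph_indicator; case: [exists _, _].
have W3 j : (3 * W j < 4 ^ size r)%N by apply: weighted_sum_lt => // c; exact: v1.
have Wl1 : (3 * (\sum_j W j) + k <= k * 4 ^ size r)%N.
  by apply: weighted_sum_l1 => // c; exact: graph_indicator_l1.
pose E : R := 4 ^+ size r.
have EE : (4 ^ size r)%:R = E by rewrite natrX.
have E0 : 0 < E by rewrite exprn_gt0.
pose z j := (W j + 4 ^ size r * (v a j + v b j))%N.
have zx j : (x 0 j)%:~R = (z j)%:R :> R by rewrite mxE.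
have zE j : (z j)%:R = (W j)%:R + E * (v a j + v b j)%:R :> R.
  by rewrite /z natrD natrM EE.
have WR j : (W j)%:R <= E / 3.
  by rewrite ler_pdivlMr // -EE -natrM ler_nat mulnC ltnW.
have l2 : eps * l2_norm R x < E / 3.
  have l2le : l2_norm R x <= Num.sqrt (3 * E * (3 * k%:R * E)).
    apply: (@l2_norm_nat_le R d z); last by rewrite mulr_ge0 // ltW.
      move=> j; rewrite zE; have := WR j.
      have : (v a j + v b j)%:R <= 2 :> R.
        by rewrite (ler_nat _ _ 2); have := v1 a j; have := v1 b j; lia.
      by move=> /(ler_wpM2l (ltW E0)); lra.
    rewrite -EE -!natrM ler_nat big_split /= -big_distrr /= big_split /=.
    have := graph_indicator_l1 iota a; have := graph_indicator_l1 iota b.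
    move: Wl1; rewrite -/v; set S := (\sum_j W j)%N; set A := (\sum_j v a j)%N.
    set B := (\sum_j v b j)%N; set F := (4 ^ size r)%N => h1 hB hA.
    by have := leq_mul (leqnn F) hA; have := leq_mul (leqnn F) hB; lia.
  apply: le_lt_trans (ler_wpM2l (ltW eps0) l2le) _.
  rewrite -ltr_pdivlMl // -[ltRHS]ger0_norm; last by rewrite mulr_ge0 ?invr_ge0 ?divr_ge0 // ltW.
  rewrite -sqrtr_sqr ltr_sqrt; last by rewrite exprn_gt0 // mulr_gt0 ?invr_gt0 ?divr_gt0.
  rewrite (_ : (_ * _) ^+ 2 = E ^+ 2 * (81 * eps ^+ 2)^-1 * 9); last first.
    by field; rewrite gt_eqF.
  rewrite (_ : 3 * E * _ = E ^+ 2 * k%:R * 9); last by ring.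
  rewrite ltr_pM2r // ltr_pM2l ?exprn_gt0 //.
  by rewrite -[ltRHS]mulr1 ltr_pdivlMl // mulr_gt0 // exprn_gt0.
move=> hout; have {hout}hout := le_lt_trans hout l2.
move: hout; rewrite ltr_norml => /andP[h1 h2].
case: (collide_graphP iota a b inj) => [[j vj]|nj].
  have := linf_norm_ge (R := R) x j; rewrite zx ger0_norm ?ler0n // zE vj => hj.
  have : 0 <= (W j)%:R :> R by rewrite ler0n.
  by rewrite -/E => ?; lra.
have : linf_norm R x <= 4 / 3 * E.
  apply: linf_norm_le => [|j]; first by rewrite mulr_ge0 // ltW.
  rewrite zx ger0_norm ?ler0n // zE.
  have : (v a j + v b j)%:R <= 1 :> R.
    rewrite (ler_nat _ _ 1); have := v1 a j; have := v1 b j.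
    have : (v a j + v b j)%N <> 2%N by move=> h; apply: nj; exists j.
    by lia.
  by move=> /(ler_wpM2l (ltW E0)); have := WR j; lra.
by rewrite -/E => ?; apply/negbTE; rewrite -leNgt; lra.
Qed.

Lemma collide_space_bound (P : probability Omega R) (A : streaming_alg R Omega d s)
    (M L : nat) (eps : R) :
  (256 <= k)%N -> (k * m <= d)%N -> (4 ^ L <= M)%N ->
  0 < eps -> 81 * eps ^+ 2 * k%:R < 1 ->
  estimates_linf P A M eps 800^-1 ->
  5^-1 * (L%:R * (k%:R * ln m%:R)) <= s%:R :> R.
Proof.
move=> k256 kmd LM eps0 epsk hA.
have km : #|{: 'I_k * 'I_m}| = (k * m)%N by rewrite card_prod !card_ord.
have cd : (#|{: 'I_k * 'I_m}| <= d)%N by rewrite km.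
pose iota (p : 'I_k * 'I_m) : 'I_d := widen_ord cd (enum_rank p).
have inj : injective iota.
  by move=> p q /(congr1 val) /= h; apply: enum_rank_inj; exact: val_inj.
pose v := graph_indicator iota.
have v1 c j : (v c j <= 1)%N by rewrite /v /graph_indicator; case: [exists _, _].
have m0 : 0 < m%:R :> R by rewrite ltr0n; lia.
have cw : #|{: word}|%:R = m%:R ^+ k :> R by rewrite card_ffun !card_ord natrX.
(* As m >= 1024, the [2 ^ k] in the list size costs only a small fraction of k ln m. *)
have lnm : 10 * ln 2 <= ln m%:R :> R.
  have -> : 10 * ln 2 = ln (2 ^+ 10) :> R by rewrite lnXn // mulr_natl.
  rewrite ler_ln ?posrE ?exprn_gt0 //.
  by rewrite -natrX ler_nat; have -> : (2 ^ 10 = 1024)%N by []; lia.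
have ln20 := ln2_ge R.
set lm := ln m%:R in lnm *.
have lnN : ln (m%:R ^+ k) = k%:R * lm :> R by rewrite lnXn // mulr_natl.
pose V : R := 2 ^+ k * m%:R ^+ k./2.
(* Taking lam = ln of the number of words makes [expR (- lam) * #|X|] equal to 1. The miss frequency
   is 2 / 800 * 40 = 1/10. *)
have : #|{: word}|%:R ^+ L * expR (- (k%:R * lm * (2 * 800^-1 / 40^-1 * L%:R)))
    <= 2 ^+ s * (V + expR (- (k%:R * lm)) * #|{: word}|%:R) ^+ L.
  apply: (@protocol_bound R word word d s L 4 v v collide dO Omega P A M eps
    800^-1 40^-1 (k%:R * lm) V (fun l => 5 / 3 * 4 ^+ l) _ _ _ _ hA).
  - by rewrite invr_gt0 ltr0n.
  - by rewrite invr_gt0 ltr0n.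
  - by apply: mulr_ge0; [exact: ler0n|lra].
  - by rewrite -(ltr0n R) cw exprn_gt0.
  - move=> p; rewrite /V -!natrX -natrM ler_nat.
    by apply: collide_list => //; lia.
  - move=> r a y j rL; rewrite mxE absz_nat; apply: leq_trans LM.
    apply: leq_trans (leq_pexp2l _ rL) => //; rewrite expnS.
    have := weighted_sum_lt 4 v r j isT (fun c => v1 c j).
    have := leq_mul (leqnn (4 ^ size r)) (v1 a j).
    by have := leq_mul (leqnn (4 ^ size r)) (v1 y j); rewrite /=; lia.
  - by move=> r a y out _; exact: collide_decoding.
rewrite cw -lnN [expR (- ln _)]expRN lnK ?posrE ?exprn_gt0 // mulVf ?gt_eqF ?exprn_gt0 //.
have V0 : 1 <= V.
  by rewrite /V -!natrX -natrM (ler_nat _ 1) muln_gt0 !expn_gt0; lia.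
rewrite -ler_ln ?posrE ?mulr_gt0 ?exprn_gt0 ?expR_gt0 //; last by lra.
rewrite !lnM ?posrE ?exprn_gt0 ?expR_gt0 //; [|by lra].
rewrite expRK !lnXn ?exprn_gt0 //; last by lra.
have lnV : ln (V + 1) <= (k%:R + 1) * ln 2 + k%:R / 2 * lm.
  apply: (@le_trans _ _ (ln (2 * V))).
    by rewrite ler_ln ?posrE; lra.
  rewrite /V !lnM ?posrE ?mulr_gt0 ?exprn_gt0 // !lnXn //.
  rewrite -!(mulr_natl (ln _)) -/lm.
  have : k./2%:R <= k%:R / 2 :> R by rewrite ler_pdivlMr // -natrM ler_nat; lia.
  have lm0 : 0 <= lm by lra.
  by move=> /(ler_wpM2r lm0); lra.
rewrite -/lm -(mulr_natl lm) -(mulr_natl (ln 2)) -(mulr_natl (ln (V + 1))).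
rewrite -(mulr_natl (_ * lm)) => hmain.
have {}hmain : L%:R * (k%:R * lm * (9 / 10) - ln (V + 1)) <= s%:R * ln 2.
  by move: hmain; rewrite (_ : 2 / 800 / 40^-1 = 10^-1) //; [lra|field].
have k1 : 1 <= k%:R :> R by rewrite (ler_nat _ 1) (leq_trans _ k256).
(* Of the factor 9/10, one half goes to the list size and at most 1/5 to (k + 1) ln 2; at least 1/5
   remains. *)
have key : 5^-1 * (k%:R * lm) <= k%:R * lm * (9 / 10) - ln (V + 1).
  have : k%:R * (10 * ln 2) <= k%:R * lm by rewrite ler_wpM2l ?ler0n.
  have : ln 2 <= k%:R * ln 2 :> R by rewrite ler_peMl //; lra.
  by lra.
have := ler_wpM2l (ler0n R L) key.
have : s%:R * ln 2 <= s%:R :> R by rewrite ler_piMr ?ler0n // ln2_le.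
by lra.
Qed.
End Meets.

(** * The space bound for [eps] bounded away from 0 *)

Section Bit.
Context {R : realType} {dO : measure_display} {Omega : measurableType dO}.
Context {d s : nat}.

Definition bit_vector (j0 : 'I_d) (a : bool) (j : 'I_d) : nat := a && (j == j0).

(** Only the coordinate [j0] is nonzero, so both norms equal its value and the error is
    multiplicative. The output is at least (1 - eps) T^(size r) if the bit is set, and at most (1 +
    eps) T^(size r) / (T - 1) if not; the condition on [T] separates the two. The query [y] carries
    no information. *)
Lemma bit_decoding (eps : R) (T : nat) j0 (r : seq bool) (a : bool) (y : unit) out :
  0 < eps < 1 -> (1 < T)%N -> 1 + eps < (1 - eps) * T.-1%:R ->
  let x := query_vector T (bit_vector j0) (fun _ _ => 0%N) r a y in
  `|out - linf_norm R x| <= eps * l2_norm R x ->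
  ((1 + eps) / T.-1%:R * T%:R ^+ size r < out) = a.
Proof.
move=> /andP[eps0 eps1] T1 hT x.
have v1 c j : (bit_vector j0 c j <= 1)%N by rewrite /bit_vector; case: (_ && _).
have W0 r' j : j != j0 -> weighted_sum T (bit_vector j0) r' j = 0%N.
  move=> /negbTE jj0; elim: r' => //= c r' ->.
  by rewrite muln0 /bit_vector jj0 andbF.
pose W := weighted_sum T (bit_vector j0) r j0.
have WT : (T.-1 * W < T ^ size r)%N by apply: weighted_sum_lt => //; lia.
pose z : R := W%:R + T%:R ^+ size r * a%:R.
have xz j : (x 0 j)%:~R = (if j == j0 then z else 0) :> R.
  rewrite mxE -[(Posz _)%:~R]/(_%:R : R) addn0; case: eqP => [->|/eqP jj0].
    by rewrite /bit_vector eqxx andbT natrD natrM natrX.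
  by rewrite W0 // /bit_vector (negbTE jj0) andbF muln0.
have z0 : 0 <= z by rewrite addr_ge0 ?mulr_ge0 ?exprn_ge0.
have linf : linf_norm R x = z.
  apply/eqP; rewrite eq_le; apply/andP; split.
    by apply: linf_norm_le => // j; rewrite xz; case: ifP => _; rewrite ?normr0 // ger0_norm.
  by have := linf_norm_ge (R := R) x j0; rewrite xz eqxx ger0_norm.
have l2 : l2_norm R x = z.
  rewrite /l2_norm (bigD1 j0) //= xz eqxx big1 ?addr0 ?sqrtr_sqr ?ger0_norm //.
  by move=> j /negbTE jj0; rewrite xz jj0 expr0n.
rewrite linf l2 ler_norml => /andP[h1 h2].
pose E : R := T%:R ^+ size r; rewrite -/E.
have T0 : 0 < T.-1%:R :> R by rewrite ltr0n; lia.
have WE : W%:R < E / T.-1%:R.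
  by rewrite ltr_pdivlMr // /E -natrX -natrM ltr_nat mulnC.
have E0 : 0 < E by rewrite exprn_gt0 // ltr0n; lia.
have W00 : 0 <= W%:R :> R by [].
rewrite /z -/E in h1 h2; clear x xz z0 linf l2 z; case: a h1 h2 => /= h1 h2.
  apply: (@lt_le_trans _ _ ((1 - eps) * E)); last first.
    have : 0 <= (1 - eps) * W%:R by rewrite mulr_ge0 // subr_ge0 ltW.
    by lra.
  by rewrite ltr_pM2r // ltr_pdivrMr.
apply/negbTE; rewrite -leNgt; rewrite mulr0 addr0 in h2 *.
have : (1 + eps) * W%:R <= (1 + eps) * (E / T.-1%:R) by rewrite ler_wpM2l ?ltW // addr_gt0.
by lra.
Qed.

(* Taking [L = 0] is meaningful: it rules out [s = 0]. *)
Lemma bit_space_bound (P : probability Omega R) (A : streaming_alg R Omega d s)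
    (M L T : nat) (eps : R) :
  (0 < d)%N -> (2 * T ^ L <= M)%N -> 0 < eps < 1 -> (1 < T)%N ->
  1 + eps < (1 - eps) * T.-1%:R ->
  estimates_linf P A M eps 800^-1 ->
  L.+1%:R <= 6 * s%:R :> R.
Proof.
move=> d0 LM eps01 T1 hT hA.
pose j0 : 'I_d := Ordinal d0; pose v := bit_vector j0.
have v1 c j : (v c j <= 1)%N by rewrite /v /bit_vector; case: (_ && _).
have ln20 := ln2_ge R.
(* Here [expR (- lam)] is 1/16 and lists have at most one element, so each level costs ln (1 + 2/16)
   <= 1/8 against a gain of (1 - 4/10) ln 2 >= 3/10. *)
have : #|{: bool}|%:R ^+ L.+1 * expR (- (4 * ln 2 * (2 * 800^-1 / 40^-1 * L.+1%:R)))
    <= 2 ^+ s * (1 + expR (- (4 * ln 2)) * #|{: bool}|%:R) ^+ L.+1 :> R.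
  apply: (@protocol_bound R bool unit d s L.+1 T v (fun _ _ => 0%N) (fun a _ => a)
    dO Omega P A M eps 800^-1 40^-1 (4 * ln 2) 1
    (fun l => (1 + eps) / T.-1%:R * T%:R ^+ l) _ _ _ _ hA).
  - by rewrite invr_gt0 ltr0n.
  - by rewrite invr_gt0 ltr0n.
  - by apply: mulr_ge0; [exact: ler0n|lra].
  - by rewrite card_unit.
  (* Two different bits cannot both be within 1/40 of the same number. *)
  - move=> p; rewrite (ler_nat _ _ 1); apply/card_le1P => a aS b.
    move: aS; rewrite !inE card_unit mulr1 !(big_pred1 tt) => [|[]|[]] //.
    rewrite !ler_norml => /andP[h1 h2].
    apply/idP/eqP => [/andP[h3 h4]|->]; last by apply/andP.
    by case: a b h1 h2 h3 h4 => -[] //=; rewrite ?mulr0n ?mulr1n; lra.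
  - move=> r a y j rL; rewrite mxE absz_nat; apply: leq_trans LM.
    rewrite addn0 mul2n -addnn; apply: (@leq_trans (T ^ size r + T ^ size r)).
      apply: leq_add; last by rewrite -[leqRHS]muln1 leq_mul2l v1 orbT.
      apply: leq_trans (ltnW (weighted_sum_lt T v r j (ltnW T1) (fun c => v1 c j))).
      by rewrite leq_pmull //; lia.
    by rewrite leq_add // leq_pexp2l // ltnW.
  - by move=> r a y out _; exact: bit_decoding.
rewrite card_bool.
have -> : expR (- (4 * ln 2)) = 16^-1 :> R.
  by rewrite expRN mulr_natl -lnXn // lnK ?posrE ?exprn_gt0 //; congr _^-1; ring.
rewrite -ler_ln ?posrE ?mulr_gt0 ?exprn_gt0 ?expR_gt0 //.
rewrite !lnM ?posrE ?exprn_gt0 ?expR_gt0 //.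
rewrite expRK !lnXn //.
rewrite -!(mulr_natl (ln _)) (_ : 2 / 800 / 40^-1 = 10^-1); last by field.
move=> h.
have h8 : ln (1 + 16^-1 * 2) <= 8^-1 :> R.
  by apply: le_trans (@le_ln1Dx R _ _) _; lra.
have := ler_wpM2l (ler0n R L.+1) h8; have := ler_wpM2l (ler0n R L.+1) ln20.
have : s%:R * ln 2 <= s%:R :> R by rewrite ler_piMr ?ler0n // ln2_le.
have : 0 <= s%:R :> R by [].
by lra.
Qed.
End Bit.

(** * Choice of the constants and conclusion *)

Theorem theorem8p5 (R : realType) :
  exists2 delta : R, 0 < delta < 1 &
  exists C0 : nat, forall C : nat, (C0 <= C)%N ->
  exists2 c : R, 0 < c &
  forall (d : nat) (eps : R), 0 < eps ->
    6 * (ln d%:R / d%:R) `^ (4^-1) <= eps ->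
  forall (dO : measure_display) (Omega : measurableType dO)
    (P : probability Omega R) (s : nat) (A : streaming_alg R Omega d s),
    estimates_linf P A (d ^ C) eps delta ->
    c * (eps ^- 2 * ln (eps^-1) * ln d%:R) <= s%:R.
Proof.
exists 800^-1; first by apply/andP; split; lra.
(* The cutoff for 1 / eps between the two regimes, kept abstract so that its powers are not
   computed. *)
have [B B150] : {B : R | B = 150} by exists 150.
have B0 : 0 < B by rewrite B150.
(* The exponent 2 leaves room for the factor 2 in the entry bound 2 T^L <= 2d <= d^2 of the
   single-bit scheme. *)
exists 2 => C C2; exists (B ^+ 4)^-1; first by rewrite invr_gt0 exprn_gt0.
move=> d eps eps0 hd dO Omega P s A hA.
have ln20 := ln2_ge R; have ln21 := ln2_le R.
have s0 : 0 <= s%:R :> R by [].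
have c0 : 0 < (B ^+ 4)^-1 by rewrite invr_gt0 exprn_gt0.
(* For d <= 1 the bound is 0, by the convention [ln 0 = 0] when d = 0; for eps >= 1 it is
   nonpositive. *)
have [d1|d2] := leqP d 1.
  move: d1; rewrite leq_eqVlt ltnS leqn0 => /orP[/eqP->|/eqP->].
    by rewrite ln1 !mulr0.
  by rewrite (ln0 (lexx 0)) !mulr0.
have dR : 2 <= d%:R :> R by rewrite (ler_nat _ 2).
have lnd : 2^-1 <= ln d%:R :> R.
  by apply: le_trans ln20 _; rewrite ler_ln ?posrE //; lra.
have lnd0 : 0 <= ln d%:R :> R by lra.
have [eps1|eps1] := lerP 1 eps.
  apply: le_trans s0; rewrite pmulr_rle0 // mulr_le0_ge0 // mulr_ge0_le0 //.
    by rewrite invr_ge0 exprn_ge0 // ltW.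
  by apply: ln_le0; rewrite invf_le1.
set e := eps^-1.
have e1 : 1 < e by rewrite /e invf_gt1.
have e0 : 0 < e by lra.
have epse : eps * e = 1 by rewrite divff // gt_eqF.
have eps2 : eps ^- 2 = e ^+ 2 by rewrite exprVn.
have lne0 : 0 <= ln e by apply: ln_ge0; exact: ltW.
rewrite eps2.
have [leB|ltB] := lerP e B.
  (* Here [ln e <= (1 - eps) e], while the base [T] is of order [1 / (1 - eps)]. *)
  pose T := (Num.truncn (4 / (1 - eps))).+2.
  have eps1' : 0 < 1 - eps by lra.
  have q0 : 0 <= 4 / (1 - eps) by rewrite divr_ge0 // ltW.
  have /andP[T1 T2] := truncn_itv q0.
  (* The offset in [T] gives T - 1 > 4 / (1 - eps), and 4 exceeds 1 + eps. *)
  have hT : 1 + eps < (1 - eps) * T.-1%:R.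
    by move: T2; rewrite ltr_pdivrMr //= mulrC; lra.
  have := @bit_space_bound R dO Omega d s P A (d ^ C) (trunc_log T d) T eps.
  rewrite eps0 eps1 => /(_ (ltnW d2)) hb.
  have {}hb : (trunc_log T d).+1%:R <= 6 * s%:R :> R.
    apply: hb => //; apply: (@leq_trans (d ^ 2)); last by rewrite leq_pexp2l // ltnW.
    by rewrite expnS expn1 leq_mul // trunc_logP // ltnW.
  have Tle : T%:R <= 6 / (1 - eps).
    rewrite /T -addn2 natrD; move: T1; rewrite !ler_pdivlMr // => T1.
    by rewrite mulrDl; lra.
  have T0 : 1 < T%:R :> R by rewrite (ltr_nat _ 1).
  have Tpos : 0 < T%:R :> R by lra.
  have dpos : 0 < d%:R :> R by lra.
  have lnT : ln T%:R <= 6 / (1 - eps).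
    by apply: le_trans Tle; apply/ltW/ln_sublinear; lra.
  have lndT : ln d%:R <= (trunc_log T d).+1%:R * ln T%:R :> R.
    rewrite mulr_natl -lnXn // ler_ln ?posrE ?exprn_gt0 //.
    by rewrite -natrX ler_nat ltnW // trunc_log_ltn.
  have h1 : ln d%:R * (1 - eps) <= 36 * s%:R.
    rewrite -ler_pdivlMr //; apply: le_trans lndT _.
    apply: (@le_trans _ _ (6 * s%:R * (6 / (1 - eps)))); last by lra.
    by rewrite ler_pM // ln_ge0 // ltW.
  have lne : ln e <= (1 - eps) * e.
    rewrite mulrBl mul1r epse -[in leLHS](subrKC 1 e).
    by apply: le_ln1Dx; lra.
  rewrite mulrC ler_pdivrMr ?exprn_gt0 //.
  apply: (@le_trans _ _ (B ^+ 3 * (ln d%:R * (1 - eps)))).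
    apply: (@le_trans _ _ (e ^+ 3 * (ln d%:R * (1 - eps)))).
      rewrite (_ : e ^+ 3 * _ = e ^+ 2 * ((1 - eps) * e) * ln d%:R); last by ring.
      by rewrite ler_wpM2r // ler_wpM2l // exprn_ge0 // ltW.
    apply: ler_wpM2r; first by apply: mulr_ge0 => //; lra.
    by apply: lerXn2r => //; rewrite ?nnegrE; lra.
  apply: (@le_trans _ _ (B ^+ 3 * (36 * s%:R))).
    by rewrite ler_wpM2l // exprn_ge0 // ltW.
  rewrite mulrCA (_ : s%:R * _ = B * (B ^+ 3 * s%:R)); last by ring.
  apply: ler_wpM2r; last by lra.
  by rewrite mulr_ge0 // exprn_ge0 // ltW.
(* Dividing by 82 makes the condition 81 eps^2 k < 1 strict, while e > 150 still gives k >= 256. *)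
pose k := Num.truncn (e ^+ 2 / 82).
have e20 : 0 <= e ^+ 2 / 82 by rewrite divr_ge0 // exprn_ge0 // ltW.
have /andP[k1 k2] := truncn_itv e20; rewrite -/k in k1 k2; rewrite -(natr1 k) in k2.
have e2 : 150 * e <= e ^+ 2 by rewrite -B150 expr2 ler_wpM2r // ltW.
have k256 : (256 <= k)%N.
  by rewrite -(ler_nat R); lra.
(* The fourth power of the hypothesis on [eps]; with ln d >= 1/2 it gives room for the 4k^2
   coordinates of the grid. *)
have hd4 : (6 * e) ^+ 4 * ln d%:R <= d%:R.
  have q0 : 0 <= ln d%:R / d%:R :> R by rewrite divr_ge0.
  have : ((ln d%:R / d%:R) `^ 4^-1) ^+ 4 <= (eps / 6) ^+ 4.
    apply: lerXn2r; rewrite ?nnegrE ?powR_ge0 //; first by rewrite divr_ge0 // ltW.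
    by rewrite ler_pdivlMr // mulrC.
  rewrite -powR_mulrn ?powR_ge0 // -powRrM mulVf // powRr1 // ler_pdivrMr; last by lra.
  have e40 : 0 <= (6 * e) ^+ 4 by rewrite exprn_ge0 // mulr_ge0 // ltW.
  move=> /(ler_wpM2l e40); rewrite mulrA -exprMn.
  have -> : 6 * e * (eps / 6) = eps * e by field.
  by rewrite epse expr1n mul1r.
have kd : (k * (4 * k) <= d)%N.
  rewrite -(ler_nat R); apply: le_trans hd4.
  have -> : (k * (4 * k))%:R = (2 * k%:R) ^+ 2 :> R by rewrite !natrM; ring.
  apply: (@le_trans _ _ ((e ^+ 2) ^+ 2 / 2)).
    apply: (@le_trans _ _ ((e ^+ 2 / 2) ^+ 2)).
      by apply: lerXn2r; rewrite ?nnegrE ?mulr_ge0 // ?invr_ge0 //; lra.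
    by rewrite expr_div_n ler_wpM2l ?exprn_ge0 ?ltW //; lra.
  rewrite -exprM; apply: ler_pM => //; first by rewrite exprn_ge0 // ltW.
  by apply: lerXn2r; rewrite ?nnegrE; lra.
have epsk : 81 * eps ^+ 2 * k%:R < 1.
  have : 81 * eps ^+ 2 * k%:R <= 81 * eps ^+ 2 * (e ^+ 2 / 82).
    by rewrite ler_wpM2l // mulr_ge0 // exprn_ge0 // ltW.
  rewrite (_ : 81 * eps ^+ 2 * (_ / _) = 81 / 82 * (eps * e) ^+ 2); last by field.
  by rewrite epse expr1n => h; apply: le_lt_trans h _; lra.
have d4 : (4 <= d)%N.
  by apply: leq_trans kd; rewrite mulnCA leq_pmulr // muln_gt0 (leq_trans _ k256).
have LM : (4 ^ trunc_log 4 d <= d ^ C)%N.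
  apply: (@leq_trans d); first by rewrite trunc_logP // ltnW.
  by rewrite -{1}(expn1 d) leq_pexp2l // ltnW.
have := collide_space_bound P A _ _ _ k256 kd LM eps0 epsk hA.
set L := trunc_log 4 d; set lk := ln _ => hs; apply: le_trans hs.
have L1 : 1 <= L%:R :> R by rewrite (ler_nat _ 1) trunc_log_gt0.
have lndL : ln d%:R <= 4 * L%:R :> R.
  have ln4 : ln 4 = 2 * ln 2 :> R.
    by rewrite mulr_natl -lnXn // expr2 -natrM.
  have d0 : 0 < d%:R :> R by lra.
  have : ln d%:R <= L.+1%:R * ln 4 :> R.
    rewrite mulr_natl -lnXn // ler_ln ?posrE ?exprn_gt0 //.
    by rewrite -natrX ler_nat ltnW // trunc_log_ltn.
  move=> /le_trans; apply; rewrite -natr1 ln4.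
  have : L%:R * ln 2 <= L%:R :> R by rewrite ler_piMr.
  by lra.
have lkE : ln e <= lk.
  rewrite ler_ln ?posrE // natrM; last first.
    by have := exprn_gt0 2 e0; lra.
  by lra.
have kE : e ^+ 2 <= 164 * k%:R by lra.
apply: (@le_trans _ _ ((B ^+ 4)^-1 * (164 * k%:R * lk * (4 * L%:R)))).
  apply: ler_wpM2l; first exact: ltW.
  have e20' : 0 <= e ^+ 2 by rewrite exprn_ge0 // ltW.
  apply: ler_pM => //; first by rewrite mulr_ge0.
  exact: ler_pM.
have : 0 <= k%:R * lk * L%:R by rewrite !mulr_ge0 // (le_trans lne0).
set Z := _ * L%:R => Z0.
rewrite (_ : 164 * k%:R * lk * _ = 656 * Z); last by rewrite /Z; ring.
rewrite (_ : L%:R * _ = Z); last by rewrite /Z; ring.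
(* It remains to check 656 <= B^4 / 5, where 656 = 164 * 4 collects the losses in [k] and [L]. *)
rewrite mulrA ler_wpM2r // ler_pdivrMl ?exprn_gt0 //.
have B1 : 1 <= B by lra.
have BB : 1 <= B * B by rewrite mulr_ege1.
have -> : B ^+ 4 = B * B * (B * B) by ring.
have : B * B <= B * B * (B * B) by rewrite ler_peMl // (le_trans ler01).
have : 150 * B <= B * B by rewrite -B150.
by lra.
Qed.
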